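(* Let $A$ be a bialgebra over a field $k$ and $\Omega(A)=(H,\triangleleft,\triangleright,f)$ an extending datum of $A$ (with $H$ carrying the unital, not necessarily associative multiplication $\cdot$). Then the following are equivalent: (1) $A\ltimes H$ is a unified product (i.e. $A\otimes H$ with the multiplication $\bullet$, unit $1_A\ltimes 1_H$ and the tensor product coalgebra structure is a bialgebra); (2) the following conditions hold for all $g,h,l\in H$ and $a,b\in A$: (2a) $\Delta_H:H\to H\otimes H$ and $\varepsilon_H:H\to k$ are (unital) algebra maps with respect to $\cdot$; (2b) $(H,\triangleleft)$ is a right $A$-module; (2c) $(g\cdot h)\cdot l=\bigl(g\triangleleft f(h_{(1)},l_{(1)})\bigr)\cdot(h_{(2)}\cdot l_{(2)})$; (2d) $g\triangleright(ab)=(g_{(1)}\triangleright a_{(1)})\bigl((g_{(2)}\triangleleft a_{(2)})\triangleright b\bigr)$; (2e) $(g\cdot h)\triangleleft a=\bigl(g\triangleleft(h_{(1)}\triangleright a_{(1)})\bigr)\cdot(h_{(2)}\triangleleft a_{(2)})$; (2f) $\bigl(g_{(1)}\triangleright(h_{(1)}\triangleright a_{(1)})\bigr)\, f\bigl(g_{(2)}\triangleleft(h_{(2)}\triangleright a_{(2)}),\,h_{(3)}\triangleleft a_{(3)}\bigr)=f(g_{(1)},h_{(1)})\bigl((g_{(2)}\cdot h_{(2)})\triangleright a\bigr)$; (2g) $\bigl(g_{(1)}\triangleright f(h_{(1)},l_{(1)})\bigr)\, f\bigl(g_{(2)}\triangleleft f(h_{(2)},l_{(2)}),\,h_{(3)}\cdot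 l_{(3)}\bigr)=f(g_{(1)},h_{(1)})\,f(g_{(2)}\cdot h_{(2)},l)$; (2h) $g_{(1)}\triangleleft a_{(1)}\otimes g_{(2)}\triangleright a_{(2)}=g_{(2)}\triangleleft a_{(2)}\otimes g_{(1)}\triangleright a_{(1)}$; (2i) $g_{(1)}\cdot h_{(1)}\otimes f(g_{(2)},h_{(2)})=g_{(2)}\cdot h_{(2)}\otimes f(g_{(1)},h_{(1)})$.
   Context: Throughout, $k$ is a field, all tensor products are over $k$, and Sweedler notation $\Delta(c)=c_{(1)}\otimes c_{(2)}$ (summation understood) is used. Let $A$ be a bialgebra. An extending datum of $A$ is a system $\Omega(A)=(H,\triangleleft,\triangleright,f)$ where: $H$ is a $k$-vector space carrying a coalgebra structure $(\Delta_H,\varepsilon_H)$ and a unital, not necessarily associative algebra structure (multiplication $\cdot:H\otimes H\to H$, unit $1_H$) such that $\Delta_H(1_H)=1_H\otimes 1_H$; and $\triangleleft:H\otimes A\to H$, $\triangleright:H\otimes A\to A$, $f:H\otimes H\to A$ are coalgebra maps (tensor products of coalgebras carrying the tensor product coalgebra structure), writing $f(g,h)=f(g\otimes h)$, satisfying the normalization conditions $h\triangleright 1_A=\varepsilon_H(h)1_A$, $1_H\triangleright a=a$, $1_H\triangleleft a=\varepsilon_A(a)1_H$, $h\triangleleft 1_A=h$, $f(h,1_H)=f(1_H,h)=\varepsilon_H(h)1_A$ for all $h\in H$, $a\in A$. Given an extending datum, $A\ltimes H$ denotes the vector space $A\otimes H$ (elements $a\otimes h$ written $a\ltimes h$) with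 the multiplication $(a\ltimes h)\bullet(c\ltimes g):=a\,(h_{(1)}\triangleright c_{(1)})\,f(h_{(2)}\triangleleft c_{(2)},\,g_{(1)})\ltimes (h_{(3)}\triangleleft c_{(3)})\cdot g_{(2)}$, unit $1_A\ltimes 1_H$, and the tensor product coalgebra structure $\Delta(a\ltimes h)=a_{(1)}\ltimes h_{(1)}\otimes a_{(2)}\ltimes h_{(2)}$, $\varepsilon(a\ltimes h)=\varepsilon_A(a)\varepsilon_H(h)$. $A\ltimes H$ is called a unified product if with these structures it is a bialgebra (in particular $\bullet$ is associative); in that case $\Omega(A)$ is called a bialgebra extending structure of $A$. *)

(* Defs.v *)
(* Tensor products of k-vector spaces are built here from
   scratch (MathComp has none): V (x) W is the type of finite formal sums
   sum_i v_i (x) w_i, where two formal sums are identified iff every bilinear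
   map out of V * W (into any k-vector space) takes the same value on them,
   i.e. the quotient realising the universal property of the tensor product. *)
From HB Require Import structures.
From mathcomp Require Import all_boot all_order all_algebra.
From Stdlib Require Import ClassicalEpsilon.
Set Implicit Arguments.
Unset Strict Implicit.
Unset Printing Implicit Defensive.
Import Order.TTheory GRing.Theory Num.Theory.
Local Open Scope ring_scope.

Definition asbool (P : Prop) : bool :=
  if excluded_middle_informative P then true else false.

Lemma asboolP (P : Prop) : reflect P (asbool P).
Proof. by rewrite /asbool; case: excluded_middle_informative => h; constructor. Qed.

Section Bilin.
Variables (k : fieldType) (V W : lmodType k).

Definition bilin (U : lmodType k) (b : V -> W -> U) : Prop :=
  [/\ forall v v' w, b (v + v') w = b v w + b v' w,
      forall a v w, b (a *: v) w = a *: b v w,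
      forall v w w', b v (w + w') = b v w + b v w' &
      forall a v w, b v (a *: w) = a *: b v w].

Definition tsum (U : zmodType) (b : V -> W -> U) (s : seq (V * W)) : U :=
  \sum_(p <- s) b p.1 p.2.

Definition teq (s t : seq (V * W)) : Prop :=
  forall (U : lmodType k) (b : V -> W -> U), bilin b -> tsum b s = tsum b t.

Definition teqb (s t : seq (V * W)) : bool := asbool (teq s t).

Lemma teq_refl s : teq s s. Proof. by []. Qed.
Lemma teq_sym s t : teq s t -> teq t s. Proof. by move=> h U b hb; rewrite h. Qed.
Lemma teq_trans s t u : teq s t -> teq t u -> teq s u.
Proof. by move=> h1 h2 U b hb; rewrite h1 // h2. Qed.

Definition canon (s : seq (V * W)) := choose (teqb s) s.

Lemma teqb_refl s : teqb s s. Proof. exact/asboolP/teq_refl. Qed.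

Lemma canon_teq s : teq s (canon s).
Proof. exact/asboolP/(chooseP (teqb_refl s)). Qed.

Lemma canon_eq s t : teq s t -> canon s = canon t.
Proof.
move=> h; rewrite /canon.
rewrite (@eq_choose _ (teqb s) (teqb t)); last first.
  move=> u; apply/asboolP/asboolP => hu.
    exact: teq_trans (teq_sym h) hu.
  exact: teq_trans h hu.
by apply: choose_id; apply/asboolP => //; apply: teq_sym.
Qed.

Lemma canon_idem s : canon (canon s) == canon s.
Proof. by apply/eqP; symmetry; apply: canon_eq; apply: canon_teq. Qed.

Record tensor := Tensor { trep : seq (V * W); _ : canon trep == trep }.

HB.instance Definition _ := [isSub for trep].
HB.instance Definition _ := [Choice of tensor by <:].

Definition tpi (s : seq (V * W)) : tensor := @Tensor (canon s) (canon_idem s).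

Lemma tpiK x : tpi (trep x) = x.
Proof. by apply: val_inj; case: x => s /= /eqP. Qed.

Lemma tpi_teq s : teq (trep (tpi s)) s.
Proof. exact/teq_sym/canon_teq. Qed.

Lemma tpiP s t : teq s t -> tpi s = tpi t.
Proof. by move=> h; apply: val_inj; rewrite /= (canon_eq h). Qed.

Lemma tsum_cat (U : zmodType) (b : V -> W -> U) s t :
  tsum b (s ++ t) = tsum b s + tsum b t.
Proof. by rewrite /tsum big_cat. Qed.

Lemma tsum_pi (U : lmodType k) (b : V -> W -> U) s :
  bilin b -> tsum b (trep (tpi s)) = tsum b s.
Proof. by move=> hb; apply: tpi_teq. Qed.

Definition tzero : tensor := tpi [::].
Definition tadd (x y : tensor) : tensor := tpi (trep x ++ trep y).
Definition topp (x : tensor) : tensor :=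
  tpi (map (fun p => (- p.1, p.2)) (trep x)).
Definition tscale (a : k) (x : tensor) : tensor :=
  tpi (map (fun p => (a *: p.1, p.2)) (trep x)).

Lemma tsum_scale (U : lmodType k) (b : V -> W -> U) a s : bilin b ->
  tsum b (map (fun p => (a *: p.1, p.2)) s) = a *: tsum b s.
Proof.
case=> _ hs _ _; rewrite /tsum big_map scaler_sumr.
by apply: eq_bigr => p _; rewrite hs.
Qed.

Lemma tsum_opp (U : lmodType k) (b : V -> W -> U) s : bilin b ->
  tsum b (map (fun p => (- p.1, p.2)) s) = - tsum b s.
Proof.
case=> _ hs _ _; rewrite /tsum big_map -sumrN.
by apply: eq_bigr => p _; rewrite /= -[- p.1]scaleN1r hs scaleN1r.
Qed.

Lemma taddA : associative tadd.
Proof.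
move=> x y z; apply: tpiP => U b hb.
by rewrite !tsum_cat !tsum_pi // !tsum_cat addrA.
Qed.

Lemma taddC : commutative tadd.
Proof. by move=> x y; apply: tpiP => U b hb; rewrite !tsum_cat addrC. Qed.

Lemma tadd0 : left_id tzero tadd.
Proof.
move=> x; rewrite -[RHS]tpiK; apply: tpiP => U b hb.
by rewrite tsum_cat tsum_pi // /tsum big_nil add0r.
Qed.

Lemma taddN : left_inverse tzero topp tadd.
Proof.
move=> x; apply: tpiP => U b hb.
by rewrite tsum_cat tsum_pi // tsum_opp // addNr /tsum big_nil.
Qed.

HB.instance Definition _ := GRing.isZmodule.Build tensor taddA taddC tadd0 taddN.

Lemma tscaleA a b x : tscale a (tscale b x) = tscale (a * b) x.
Proof.
apply: tpiP => U c hc.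
by rewrite !tsum_scale // tsum_pi // tsum_scale // scalerA.
Qed.

Lemma tscale1 : left_id 1 tscale.
Proof.
move=> x; rewrite -[RHS]tpiK; apply: tpiP => U c hc.
by rewrite tsum_scale // scale1r.
Qed.

Lemma tscaleDr : right_distributive tscale (@GRing.add tensor).
Proof.
move=> a x y; apply: tpiP => U c hc.
rewrite tsum_scale // tsum_pi // !tsum_cat !tsum_pi // !tsum_scale //.
by rewrite scalerDr.
Qed.

Lemma tscaleDl x : {morph tscale^~ x : a b / a + b}.
Proof.
move=> a b; apply: tpiP => U c hc.
rewrite tsum_scale // /GRing.add /= /tadd tsum_cat !tsum_pi // !tsum_scale //.
by rewrite scalerDl.
Qed.

HB.instance Definition _ :=
  GRing.Zmodule_isLmodule.Build k tensor tscaleA tscale1 tscaleDr tscaleDl.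

Definition tmul (v : V) (w : W) : tensor := tpi [:: (v, w)].

(* Sweedler-style evaluation: for a bilinear b, tlift b is the unique linear
   map V (x) W -> U with tlift b (v (x) w) = b v w. *)
Definition tlift (U : zmodType) (b : V -> W -> U) (x : tensor) : U :=
  tsum b (trep x).

End Bilin.

Arguments tensor {k} V W.
Arguments tmul {k V W}.
Arguments tlift {k V W U}.
Notation "v \ot w" := (tmul v w) (at level 40, left associativity).

Section Bialgebras.
Variable k : fieldType.

Definition linmap (V W : lmodType k) (g : V -> W) : Prop :=
  forall a x y, g (a *: x + y) = a *: g x + g y.
Definition linform (V : lmodType k) (g : V -> k) : Prop :=
  forall a x y, g (a *: x + y) = a * g x + g y.

(* Sweedler sum with three legs, c_(1) (x) c_(2) (x) c_(3), computed as
   (Delta (x) id) Delta; by coassociativity any bracketing gives the same. *)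
Definition sw3 (V : lmodType k) (U : zmodType) (D : V -> tensor V V)
  (F : V -> V -> V -> U) (c : V) : U :=
  tlift (fun c' c3 => tlift (fun c1 c2 => F c1 c2 c3) (D c')) (D c).

Record coalgebra (V : lmodType k) (D : V -> tensor V V) (e : V -> k) : Prop := {
  coalg_linD : linmap D;
  coalg_line : linform e;
  coalg_coassoc : forall c,
    tlift (fun c1 c2 => tlift (fun x y => x \ot (y \ot c2)) (D c1)) (D c)
    = tlift (fun c1 c2 => c1 \ot D c2) (D c);
  coalg_counitl : forall c, tlift (fun c1 c2 => e c1 *: c2) (D c) = c;
  coalg_counitr : forall c, tlift (fun c1 c2 => e c2 *: c1) (D c) = c }.

Record bialgebra (V : lmodType k) (m : V -> V -> V) (u : V)
    (D : V -> tensor V V) (e : V -> k) : Prop := {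
  bialg_coalg : coalgebra D e;
  bialg_bilin : bilin m;
  bialg_assoc : associative m;
  bialg_unitl : left_id u m;
  bialg_unitr : right_id u m;
  bialg_Dmul : forall x y,
    D (m x y) = tlift (fun x1 x2 => tlift (fun y1 y2 => m x1 y1 \ot m x2 y2) (D y)) (D x);
  bialg_D1 : D u = u \ot u;
  bialg_emul : forall x y, e (m x y) = e x * e y;
  bialg_e1 : e u = 1 }.

Section Extending.
Variables (A : lmodType k) (mA : A -> A -> A) (oneA : A)
  (DA : A -> tensor A A) (eA : A -> k).
Variables (H : lmodType k) (mH : H -> H -> H) (oneH : H)
  (DH : H -> tensor H H) (eH : H -> k).
(* ra h a = h <| a ,  la h a = h |> a ,  f g h = f(g, h).  Maps out of H (x) A
   resp. H (x) H are given, via the universal property, as bilinear maps. *)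
Variables (ra : H -> A -> H) (la : H -> A -> A) (f : H -> H -> A).

Record extending_datum : Prop := {
  ed_coalg : coalgebra DH eH;
  ed_mul_bilin : bilin mH;
  ed_unitl : left_id oneH mH;
  ed_unitr : right_id oneH mH;
  ed_D1 : DH oneH = oneH \ot oneH;
  ed_ra_bilin : bilin ra;
  ed_la_bilin : bilin la;
  ed_f_bilin : bilin f;
  ed_ra_D : forall h a,
    DH (ra h a) = tlift (fun h1 h2 => tlift (fun a1 a2 => ra h1 a1 \ot ra h2 a2) (DA a)) (DH h);
  ed_ra_e : forall h a, eH (ra h a) = eH h * eA a;
  ed_la_D : forall h a,
    DA (la h a) = tlift (fun h1 h2 => tlift (fun a1 a2 => la h1 a1 \ot la h2 a2) (DA a)) (DH h);
  ed_la_e : forall h a, eA (la h a) = eH h * eA a;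
  ed_f_D : forall g h,
    DA (f g h) = tlift (fun g1 g2 => tlift (fun h1 h2 => f g1 h1 \ot f g2 h2) (DH h)) (DH g);
  ed_f_e : forall g h, eA (f g h) = eH g * eH h;
  ed_la1 : forall h, la h oneA = eH h *: oneA;
  ed_1la : forall a, la oneH a = a;
  ed_1ra : forall a, ra oneH a = eA a *: oneH;
  ed_ra1 : forall h, ra h oneA = h;
  ed_f1 : forall h, f h oneH = eH h *: oneA;
  ed_1f : forall h, f oneH h = eH h *: oneA }.

Definition unif_mul_el (a : A) (h : H) (c : A) (g : H) : tensor A H :=
  sw3 DH (fun h1 h2 h3 =>
    sw3 DA (fun c1 c2 c3 =>
      tlift (fun g1 g2 =>
        mA (mA a (la h1 c1)) (f (ra h2 c2) g1) \ot mH (ra h3 c3) g2) (DH g)) c) h.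

Definition unif_mul (x y : tensor A H) : tensor A H :=
  tlift (fun a h => tlift (fun c g => unif_mul_el a h c g) y) x.

Definition unif_one : tensor A H := oneA \ot oneH.

Definition unif_D (x : tensor A H) : tensor (tensor A H) (tensor A H) :=
  tlift (fun a h => tlift (fun a1 a2 =>
     tlift (fun h1 h2 => (a1 \ot h1) \ot (a2 \ot h2)) (DH h)) (DA a)) x.

Definition unif_e (x : tensor A H) : k := tlift (fun a h => eA a * eH h) x.

Definition unified_product : Prop :=
  bialgebra unif_mul unif_one unif_D unif_e.

Record unified_conditions : Prop := {
  c2a_Dmul : forall g h,
    DH (mH g h) = tlift (fun g1 g2 => tlift (fun h1 h2 => mH g1 h1 \ot mH g2 h2) (DH h)) (DH g);
  c2a_D1 : DH oneH = oneH \ot oneH;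
  c2a_emul : forall g h, eH (mH g h) = eH g * eH h;
  c2a_e1 : eH oneH = 1;
  c2b_assoc : forall h a b, ra (ra h a) b = ra h (mA a b);
  c2b_unit : forall h, ra h oneA = h;
  c2c : forall g h l,
    mH (mH g h) l
    = tlift (fun h1 h2 => tlift (fun l1 l2 => mH (ra g (f h1 l1)) (mH h2 l2)) (DH l)) (DH h);
  c2d : forall g a b,
    la g (mA a b)
    = tlift (fun g1 g2 => tlift (fun a1 a2 => mA (la g1 a1) (la (ra g2 a2) b)) (DA a)) (DH g);
  c2e : forall g h a,
    ra (mH g h) a
    = tlift (fun h1 h2 => tlift (fun a1 a2 => mH (ra g (la h1 a1)) (ra h2 a2)) (DA a)) (DH h);
  c2f : forall g h a,
    tlift (fun g1 g2 => sw3 DH (fun h1 h2 h3 => sw3 DA (fun a1 a2 a3 =>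
       mA (la g1 (la h1 a1)) (f (ra g2 (la h2 a2)) (ra h3 a3))) a) h) (DH g)
    = tlift (fun g1 g2 => tlift (fun h1 h2 => mA (f g1 h1) (la (mH g2 h2) a)) (DH h)) (DH g);
  c2g : forall g h l,
    tlift (fun g1 g2 => sw3 DH (fun h1 h2 h3 => sw3 DH (fun l1 l2 l3 =>
       mA (la g1 (f h1 l1)) (f (ra g2 (f h2 l2)) (mH h3 l3))) l) h) (DH g)
    = tlift (fun g1 g2 => tlift (fun h1 h2 => mA (f g1 h1) (f (mH g2 h2) l)) (DH h)) (DH g);
  c2h : forall g a,
    tlift (fun g1 g2 => tlift (fun a1 a2 => ra g1 a1 \ot la g2 a2) (DA a)) (DH g)
    = tlift (fun g1 g2 => tlift (fun a1 a2 => ra g2 a2 \ot la g1 a1) (DA a)) (DH g);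
  c2i : forall g h,
    tlift (fun g1 g2 => tlift (fun h1 h2 => mH g1 h1 \ot f g2 h2) (DH h)) (DH g)
    = tlift (fun g1 g2 => tlift (fun h1 h2 => mH g2 h2 \ot f g1 h1) (DH h)) (DH g) }.

End Extending.
End Bialgebras.

(* Main.v *)
(* Composites of coalgebra maps are coalgebra maps, and a coalgebra map into
   A (x) H is determined by its projections id (x) eps and eps (x) id.  Two coalgebra
   maps p : C -> A and q : C -> B pair to the coalgebra map c |-> p(c_(1)) (x) q(c_(2))
   iff p(c_(1)) (x) q(c_(2)) = p(c_(2)) (x) q(c_(1)).  The product of A |>< H is built
   from left multiplication by A and the two pairings
     h (x) c |-> h_(1) |> c_(1) (x) h_(2) <| c_(2),
     g (x) h |-> f(g_(1), h_(1)) (x) g_(2) . h_(2),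
   which are the products (1 (x) h)(c (x) 1) and (1 (x) g)(1 (x) h); so (2a), (2h) and
   (2i) say that it is a coalgebra map.  Associativity then only has to be compared
   after the two projections: on the triples (g, a, b), (g, h, a), (g, h, l) of
   elements of A and H this gives (2d), (2b); (2f), (2e); (2g), (2c), while (g, a, l)
   is automatic.  The product is left A-linear and a (x) h = (a (x) 1)(1 (x) h), so
   these triples suffice by the pentagon relation between associators. *)
Require Import Defs.
From HB Require Import structures.
From mathcomp Require Import all_boot all_order all_algebra.
Set Implicit Arguments.
Unset Strict Implicit.
Unset Printing Implicit Defensive.
Import GRing.Theory.
Local Open Scope ring_scope.

(** * Linear maps out of tensor products *)

Section Linear.
Variable k : fieldType.
Implicit Types U V W X Y : lmodType k.

Lemma linmapD V W (g : V -> W) : linmap g -> {morph g : x y / x + y}.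
Proof. by move=> hg x y; have := hg 1 x y; rewrite !scale1r. Qed.

Lemma linmap0 V W (g : V -> W) : linmap g -> g 0 = 0.
Proof. by move=> /linmapD hg; apply: (addrI (g 0)); rewrite -hg !addr0. Qed.

Lemma bilinI U V W (b : V -> W -> U) :
  (forall w, linmap (b ^~ w)) -> (forall v, linmap (b v)) -> bilin b.
Proof.
move=> hl hr; split=> [v v' w|a v w|v w w'|a v w].
- exact: (linmapD (hl w)).
- by have := hl w a v 0; rewrite !(addr0, linmap0 (hl w)).
- exact: (linmapD (hr v)).
- by have := hr v a w 0; rewrite !(addr0, linmap0 (hr v)).
Qed.

Lemma linmap_bl U V W (X : lmodType k) (b : V -> W -> U) (g : X -> V) w :
  bilin b -> linmap g -> linmap (fun x => b (g x) w).
Proof. by case=> hD hZ _ _ hg a x y; rewrite hg hD hZ. Qed.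

Lemma linmap_br U V W (X : lmodType k) (b : V -> W -> U) (g : X -> W) v :
  bilin b -> linmap g -> linmap (fun x => b v (g x)).
Proof. by case=> _ _ hD hZ hg a x y; rewrite hg hD hZ. Qed.

Lemma linmap_comp U V W (g : V -> W) (h : U -> V) :
  linmap g -> linmap h -> linmap (fun x => g (h x)).
Proof. by move=> hg hh a x y; rewrite hh hg. Qed.

Lemma linmap_id V : linmap (fun x : V => x).
Proof. by []. Qed.

Lemma linmap_scalel U V (g : U -> k^o) (v : V) :
  linmap g -> linmap (fun x => g x *: v).
Proof. by move=> hg a x y; rewrite hg scalerDl -scalerA. Qed.

Lemma linmap_scaler U V (g : U -> V) c : linmap g -> linmap (fun x => c *: g x).
Proof. by move=> hg a x y; rewrite hg scalerDr !scalerA mulrC. Qed.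

(** Scaling in [k^o] is multiplication in [k] by conversion, so counits can be treated as linear
    maps. *)
Lemma linform_linmap V (g : V -> k) : linform g -> linmap (g : V -> k^o).
Proof. by []. Qed.

Lemma linmap_mull U (g : U -> k^o) (c : k) :
  linmap g -> linmap (fun x => (g x * c : k^o)).
Proof. by move=> hg a x y; rewrite hg mulrDl -mulrA. Qed.

Lemma linmap_mulr U (g : U -> k^o) (c : k) :
  linmap g -> linmap (fun x => (c * g x : k^o)).
Proof. by move=> hg a x y; rewrite hg mulrDr mulrCA. Qed.

Lemma linmapZ V W (g : V -> W) : linmap g -> forall a x, g (a *: x) = a *: g x.
Proof. by move=> hg a x; have := hg a x 0; rewrite !(addr0, linmap0 hg). Qed.

Lemma linformZ V (g : V -> k) : linform g -> forall a x, g (a *: x) = a * g x.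
Proof. by move=> hg; exact: (linmapZ (linform_linmap hg)). Qed.

Lemma tmul_bilin V W : bilin (@tmul k V W).
Proof.
apply: bilinI => [w a x y|v a x y]; apply: tpiP => U b hb;
  rewrite tsum_cat !tsum_pi // tsum_scale // tsum_pi // /tsum !big_seq1 /=;
  case: hb => h1 h2 h3 h4.
- by rewrite h1 h2.
- by rewrite h3 h4.
Qed.

Lemma tlift_tmul U V W (b : V -> W -> U) v w : bilin b -> tlift b (v \ot w) = b v w.
Proof. by move=> hb; rewrite /tlift tsum_pi // /tsum big_seq1. Qed.

Lemma linmap_tlift U V W (b : V -> W -> U) : bilin b -> linmap (tlift b).
Proof. by move=> hb a x y; rewrite /tlift tsum_pi // tsum_cat tsum_pi // tsum_scale. Qed.

Lemma linmap_tliftf U V W X (F : X -> V -> W -> U) t :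
  (forall v w, linmap (fun x => F x v w)) -> linmap (fun x => tlift (F x) t).
Proof.
move=> hF a x y; rewrite /tlift /tsum scaler_sumr -big_split /=.
by apply: eq_bigr => p _; rewrite hF.
Qed.

(** [tlift] unfolds to a finite sum over the chosen representative of the tensor; this congruence
    and the exchange law below are facts about finite sums. *)
Lemma eq_tlift (U : zmodType) V W (b c : V -> W -> U) t :
  (forall v w, b v w = c v w) -> tlift b t = tlift c t.
Proof. by move=> h; apply: eq_bigr => p _; rewrite h. Qed.

Lemma tlift_exchange (U : zmodType) V W X Y (F : V -> W -> X -> Y -> U) s t :
  tlift (fun v w => tlift (F v w) s) t
  = tlift (fun x y => tlift (fun v w => F v w x y) t) s.
Proof. exact: exchange_big. Qed.

Lemma linmap_tliftE U V W X (g : U -> X) (b : V -> W -> U) t :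
  linmap g -> g (tlift b t) = tlift (fun v w => g (b v w)) t.
Proof.
move=> hg; rewrite /tlift /tsum.
by apply: (big_morph g (linmapD hg) (linmap0 hg)).
Qed.

Lemma tlift_tlift U V W X Y (b : V -> W -> U) (c : X -> Y -> tensor V W) t :
  bilin b -> tlift b (tlift c t) = tlift (fun x y => tlift b (c x y)) t.
Proof. by move=> hb; rewrite (linmap_tliftE _ _ (linmap_tlift hb)). Qed.

Lemma bilin_tliftl U V W X Y (b : V -> W -> U) (c : X -> Y -> V) t w : bilin b ->
  b (tlift c t) w = tlift (fun x y => b (c x y) w) t.
Proof.
move=> hb; exact: (linmap_tliftE _ _ (linmap_bl w hb (@linmap_id V))).
Qed.

Lemma bilin_tliftr U V W X Y (b : V -> W -> U) (c : X -> Y -> W) t v : bilin b ->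
  b v (tlift c t) = tlift (fun x y => b v (c x y)) t.
Proof.
move=> hb; exact: (linmap_tliftE _ _ (linmap_br v hb (@linmap_id W))).
Qed.

Definition tmul_tliftl V W X Y c t w := @bilin_tliftl _ V W X Y _ c t w (tmul_bilin V W).
Definition tmul_tliftr V W X Y c t v := @bilin_tliftr _ V W X Y _ c t v (tmul_bilin V W).

Lemma tmulZl V W a (v : V) (w : W) : (a *: v) \ot w = a *: (v \ot w).
Proof. by case: (tmul_bilin V W). Qed.

Lemma tmulZr V W a (v : V) (w : W) : v \ot (a *: w) = a *: (v \ot w).
Proof. by case: (tmul_bilin V W). Qed.

Lemma tmul_scale V W a b (v : V) (w : W) : (a *: v) \ot (b *: w) = (a * b) *: (v \ot w).
Proof. by rewrite tmulZl tmulZr scalerA. Qed.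

(** Equality of tensors is tested against every bilinear [b]: the linear map [tlift b] turns the sum
    of the pure tensors in the representative of [x] into the sum of their values under [b]. *)
Lemma tensorE V W (x : tensor V W) : tlift tmul x = x.
Proof.
rewrite -[RHS]tpiK -[LHS]tpiK; apply: tpiP => U b hb.
rewrite -[LHS]/(tlift b _) (linmap_tliftE _ _ (linmap_tlift hb)).
by apply: eq_tlift => v w; rewrite tlift_tmul.
Qed.

Lemma tensor_ext U V W (g h : tensor V W -> U) :
  linmap g -> linmap h -> (forall v w, g (v \ot w) = h (v \ot w)) -> g =1 h.
Proof.
move=> hg hh e x; rewrite -[x]tensorE !linmap_tliftE //; exact: eq_tlift.
Qed.

End Linear.

(* Each variable occurs only once in a multilinear expression, so at most one
   argument position of every node can be the non-constant one and no search is
   needed. *)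
Ltac atom := first [eassumption | solve [auto 2 using tmul_bilin with nocore]].
Ltac lin_step :=
  cbv beta;
  lazymatch goal with
  | |- forall _, _ => intro
  | |- bilin _ => first [atom | apply: bilinI]
  | |- linmap _ =>
    first
      [ atom
      | exact: linmap_id
      | apply: linmap_tlift
      | apply: linmap_tliftf
      | apply: (linmap_comp (linmap_tlift _))
      | eapply linmap_bl; [atom | ]
      | eapply linmap_br; [atom | ]
      | apply: linmap_scalel
      | apply: linmap_scaler
      | apply: linmap_mull
      | apply: linmap_mulr
      | eapply linmap_comp; [atom | ]
      | apply: linform_linmap; atom
      | eapply linmap_comp; [apply: linform_linmap; atom | ] ]
  end.
Ltac lin := solve [repeat lin_step].

(** * The tensor product of two coalgebras *)

Section TensorCoalgebra.
Variable k : fieldType.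

(** Coassociativity in Sweedler form: the linear map induced by the trilinear [F] on the triple
    tensor product is applied to the axiom. *)
Lemma coassocE (V U : lmodType k) (D : V -> tensor V V) e (F : V -> V -> V -> U) c :
  coalgebra D e ->
  (forall y z, linmap (fun x => F x y z)) -> (forall x z, linmap (fun y => F x y z)) ->
  (forall x y, linmap (F x y)) ->
  tlift (fun c1 c2 => tlift (fun x y => F x y c2) (D c1)) (D c)
  = tlift (fun c1 c2 => tlift (F c1) (D c2)) (D c).
Proof.
case=> lD _ hD _ _ h1 h2 h3.
have b2 x : bilin (F x) by lin.
have b1 : bilin (fun x t => tlift (F x) t) by lin.
have := congr1 (tlift (fun x t => tlift (F x) t)) (hD c).
rewrite !(linmap_tliftE _ _ (linmap_tlift b1)) => h.
transitivity (tlift (fun c1 c2 => tlift (fun x t => tlift (F x) t)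
   (tlift (fun x y => x \ot (y \ot c2)) (D c1))) (D c)).
  apply: eq_tlift => v w; rewrite (linmap_tliftE _ _ (linmap_tlift b1)).
  by apply: eq_tlift => x y; rewrite !tlift_tmul.
rewrite h; apply: eq_tlift => v w; by rewrite tlift_tmul.
Qed.

Variables (V W : lmodType k) (DV : V -> tensor V V) (eV : V -> k)
  (DW : W -> tensor W W) (eW : W -> k).
Hypotheses (cV : coalgebra DV eV) (cW : coalgebra DW eW).

Let lDV := coalg_linD cV.
Let lDW := coalg_linD cW.
Let leV := coalg_line cV.
Let leW := coalg_line cW.

Let bD : bilin (fun v w => tlift (fun v1 v2 => tlift (fun w1 w2 =>
  (v1 \ot w1) \ot (v2 \ot w2)) (DW w)) (DV v)).
Proof. lin. Qed.

Lemma linmap_tensorD : linmap (unif_D DV DW).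
Proof. rewrite /unif_D; lin. Qed.

Lemma tensorD_tmul v w : unif_D DV DW (v \ot w) = tlift (fun v1 v2 => tlift (fun w1 w2 =>
  (v1 \ot w1) \ot (v2 \ot w2)) (DW w)) (DV v).
Proof. by rewrite /unif_D tlift_tmul. Qed.

Lemma tlift_tensorD (U : lmodType k) (b : tensor V W -> tensor V W -> U) v w : bilin b ->
  tlift b (unif_D DV DW (v \ot w)) = tlift (fun v1 v2 => tlift (fun w1 w2 =>
  b (v1 \ot w1) (v2 \ot w2)) (DW w)) (DV v).
Proof.
move=> hb; rewrite tensorD_tmul (linmap_tliftE _ _ (linmap_tlift hb)).
apply: eq_tlift => v1 v2; rewrite (linmap_tliftE _ _ (linmap_tlift hb)).
by apply: eq_tlift => w1 w2; rewrite tlift_tmul.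
Qed.


Lemma linform_tensore : linform (unif_e eV eW).
Proof.
have b : @bilin k V W k^o (fun v w => eV v * eW w) by lin.
exact: (linmap_tlift b).
Qed.

Lemma tensore_tmul v w : unif_e eV eW (v \ot w) = eV v * eW w.
Proof.
have b : @bilin k V W k^o (fun v w => eV v * eW w) by lin.
exact: (tlift_tmul v w b).
Qed.


Lemma tensor_coalgebra : coalgebra (unif_D DV DW) (unif_e eV eW).
Proof.
have lD := linmap_tensorD; have le := linform_tensore.
split=> //.
- apply: tensor_ext; [lin | lin | move=> v w].
  rewrite !tlift_tensorD; [| lin | lin].
  transitivity (tlift (fun v1 v2 => tlift (fun w1 w2 => tlift (fun x1 y1 =>
     tlift (fun x2 y2 => (x1 \ot x2) \ot ((y1 \ot y2) \ot (v2 \ot w2))) (DW w1)) (DV v1)) (DW w)) (DV v)).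
    by do 2!apply: eq_tlift => ? ?; rewrite tlift_tensorD //; lin.
  transitivity (tlift (fun v1 v2 => tlift (fun w1 w2 => tlift (fun x1 y1 =>
     tlift (fun x2 y2 => (v1 \ot w1) \ot ((x1 \ot x2) \ot (y1 \ot y2))) (DW w2))
        (DV v2)) (DW w)) (DV v)); last first.
    do 2!apply: eq_tlift => ? ?; rewrite tensorD_tmul tmul_tliftr.
    by apply: eq_tlift => ? ?; rewrite tmul_tliftr.
  (* Moving both splittings of [v] outside those of [w] lets coassociativity be used first in [V],
     then in [W]. *)
  under eq_tlift => v1 v2 do rewrite tlift_exchange.
  under [RHS]eq_tlift => v1 v2 do rewrite tlift_exchange.
  rewrite (coassocE (F := fun v1 v2 v3 => tlift (fun w1 w2 => tlift (fun x2 y2 =>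
    (v1 \ot x2) \ot ((v2 \ot y2) \ot (v3 \ot w2))) (DW w1)) (DW w)) v cV); [|lin..].
  apply: eq_tlift => x y; apply: eq_tlift => x' y'.
  by rewrite (coassocE (F := fun w1 w2 w3 =>
    (x \ot w1) \ot ((x' \ot w2) \ot (y' \ot w3))) w cW); [|lin..].
- apply: tensor_ext; [lin | lin | move=> v w].
  rewrite tlift_tensorD; last lin.
  rewrite -[v in RHS](coalg_counitl cV) -[w in RHS](coalg_counitl cW) tmul_tliftl.
  apply: eq_tlift => v1 v2; rewrite tmul_tliftr.
  apply: eq_tlift => w1 w2; rewrite tensore_tmul.
  by rewrite tmul_scale.
- apply: tensor_ext; [lin | lin | move=> v w].
  rewrite tlift_tensorD; last lin.
  rewrite -[v in RHS](coalg_counitr cV) -[w in RHS](coalg_counitr cW) tmul_tliftl.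
  apply: eq_tlift => v1 v2; rewrite tmul_tliftr.
  by apply: eq_tlift => w1 w2; rewrite tensore_tmul tmul_scale.
Qed.

End TensorCoalgebra.

(** * Coalgebra maps into a tensor product *)

Section Pairing.
Variable k : fieldType.

Definition comult (V W : lmodType k) (DV : V -> tensor V V) (DW : W -> tensor W W)
  (g : V -> W) := forall v, DW (g v) = tlift (fun v1 v2 => g v1 \ot g v2) (DV v).

Lemma tlift_comult (U V W : lmodType k) (DV : V -> tensor V V) (DW : W -> tensor W W)
  (g : V -> W) (b : W -> W -> U) v : bilin b -> comult DV DW g ->
  tlift b (DW (g v)) = tlift (fun v1 v2 => b (g v1) (g v2)) (DV v).
Proof.
move=> hb hg; rewrite hg tlift_tlift //.
by apply: eq_tlift => v1 v2; rewrite tlift_tmul.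
Qed.

Lemma tlift_comult2 (U V W Z : lmodType k) (DU : U -> tensor U U)
  (DV : V -> tensor V V) (DW : W -> tensor W W) (g : V -> W -> U) (b : U -> U -> Z) v w :
  bilin b ->
  DU (g v w) = tlift (fun v1 v2 => tlift (fun w1 w2 => g v1 w1 \ot g v2 w2) (DW w)) (DV v) ->
  tlift b (DU (g v w)) =
  tlift (fun v1 v2 => tlift (fun w1 w2 => b (g v1 w1) (g v2 w2)) (DW w)) (DV v).
Proof.
move=> hb ->; rewrite tlift_tlift //; apply: eq_tlift => v1 v2.
by rewrite tlift_tlift //; apply: eq_tlift => w1 w2; rewrite tlift_tmul.
Qed.

Lemma comult_tlift (U V W : lmodType k) (DU : U -> tensor U U) eU
  (DV : V -> tensor V V) eV (DW : W -> tensor W W) eW (b : V -> W -> U) :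
  coalgebra DU eU -> coalgebra DV eV -> coalgebra DW eW -> bilin b ->
  (forall v w, DU (b v w) = tlift (fun v1 v2 => tlift (fun w1 w2 =>
     b v1 w1 \ot b v2 w2) (DW w)) (DV v)) ->
  comult (unif_D DV DW) DU (tlift b).
Proof.
move=> cU cV cW hb h; have lU := coalg_linD cU; have lD := linmap_tensorD cV cW.
apply: tensor_ext; [lin | lin | move=> v w].
rewrite tlift_tmul // h (tlift_tensorD cV cW); last lin.
by do 2!apply: eq_tlift => ? ?; rewrite !tlift_tmul.
Qed.

Lemma tensore_tlift (U V W : lmodType k) (eU : U -> k) (eV : V -> k) (eW : W -> k)
  (b : V -> W -> U) :
  linform eU -> linform eV -> linform eW -> bilin b ->
  (forall v w, eU (b v w) = eV v * eW w) ->
  forall t, eU (tlift b t) = unif_e eV eW t.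
Proof.
move=> lU lV lW hb h.
have b' : @bilin k V W k^o (fun v w => eV v * eW w) by lin.
apply: (@tensor_ext k k^o); [lin | exact: linmap_tlift | move=> v w].
by rewrite tlift_tmul // h /unif_e (tlift_tmul (U := k^o)).
Qed.

Variables (A B C : lmodType k) (DA : A -> tensor A A) (eA : A -> k)
  (DB : B -> tensor B B) (eB : B -> k) (DC : C -> tensor C C) (eC : C -> k).
Hypotheses (cA : coalgebra DA eA) (cB : coalgebra DB eB) (cC : coalgebra DC eC).
Variables (p : C -> A) (q : C -> B).
Hypotheses (lp : linmap p) (lq : linmap q).

Let lDA := coalg_linD cA.
Let lDB := coalg_linD cB.
Let lDC := coalg_linD cC.
Let leA := coalg_line cA.
Let leB := coalg_line cB.
Let leC := coalg_line cC.

Definition proj1 (x : tensor A B) : A := tlift (fun a b => eB b *: a) x.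
Definition proj2 (x : tensor A B) : B := tlift (fun a b => eA a *: b) x.
Definition pairing (c : C) : tensor A B := tlift (fun c1 c2 => p c1 \ot q c2) (DC c).

Lemma linmap_proj1 : linmap proj1. Proof. by rewrite /proj1; lin. Qed.
Lemma linmap_proj2 : linmap proj2. Proof. by rewrite /proj2; lin. Qed.
Lemma linmap_pairing : linmap pairing. Proof. by rewrite /pairing; lin. Qed.
Let l1 := linmap_proj1.
Let l2 := linmap_proj2.
Let l3 := linmap_pairing.
Let l4 := linmap_tensorD cA cB.

Lemma proj1_tmul a b : proj1 (a \ot b) = eB b *: a.
Proof. by rewrite /proj1 tlift_tmul //; lin. Qed.

Lemma proj2_tmul a b : proj2 (a \ot b) = eA a *: b.
Proof. by rewrite /proj2 tlift_tmul //; lin. Qed.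

(** By the counit laws the pairing of the two projections is the identity. Hence a comultiplicative
    map into the tensor product can be recovered from its projections. *)
Lemma tensor_proj x :
  tlift (fun x1 x2 => proj1 x1 \ot proj2 x2) (unif_D DA DB x) = x.
Proof.
move: x; apply: tensor_ext; [lin | lin | move=> a b].
rewrite (tlift_tensorD cA cB); last lin.
rewrite -[a in RHS](coalg_counitr cA) -[b in RHS](coalg_counitl cB) tmul_tliftl.
apply: eq_tlift => a1 a2; rewrite tmul_tliftr.
by apply: eq_tlift => b1 b2; rewrite proj1_tmul proj2_tmul !tmul_scale mulrC.
Qed.

(** Projecting the two legs in the opposite order gives the flip; comparing the two orders is what
    yields the commutation conditions. *)
Lemma tensor_flip x :
  tlift (fun x1 x2 => proj2 x1 \ot proj1 x2) (unif_D DA DB x)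
  = tlift (fun a b => b \ot a) x.
Proof.
move: x; apply: tensor_ext; [lin | lin | move=> a b].
rewrite (tlift_tensorD cA cB); last lin.
rewrite tlift_tmul; last lin.
rewrite -[a in RHS](coalg_counitl cA) -[b in RHS](coalg_counitr cB) tmul_tliftr.
apply: eq_tlift => a1 a2; rewrite tmul_tliftl.
by apply: eq_tlift => b1 b2; rewrite proj1_tmul proj2_tmul !tmul_scale mulrC.
Qed.

(** The projection to [B] respects comultiplication, since the counit of [A] absorbs both legs of
    [a]. *)
Lemma tensor_proj22 x :
  tlift (fun x1 x2 => proj2 x1 \ot proj2 x2) (unif_D DA DB x) = DB (proj2 x).
Proof.
move: x; apply: tensor_ext; [lin | lin | move=> a b].
rewrite (tlift_tensorD cA cB); last lin.
have lb : linmap (fun a => eA a *: DB b) by lin.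
rewrite proj2_tmul (linmapZ lDB) -[a in RHS](coalg_counitl cA) (linmap_tliftE _ _ lb).
apply: eq_tlift => a1 a2; rewrite -[DB b in RHS]tensorE.
rewrite (linmap_tliftE _ _ (linmap_scaler _ (@linmap_id _ _))).
apply: eq_tlift => b1 b2; rewrite !proj2_tmul tmul_scale.
by rewrite (linformZ leA).
Qed.

Lemma proj1_pairing c : (forall c, eB (q c) = eC c) -> proj1 (pairing c) = p c.
Proof.
move=> hq; rewrite /pairing (linmap_tliftE _ _ l1) -[c in RHS](coalg_counitr cC).
rewrite (linmap_tliftE _ _ lp); apply: eq_tlift => c1 c2.
by rewrite proj1_tmul hq (linmapZ lp).
Qed.

Lemma proj2_pairing c : (forall c, eA (p c) = eC c) -> proj2 (pairing c) = q c.
Proof.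
move=> hp; rewrite /pairing (linmap_tliftE _ _ l2) -[c in RHS](coalg_counitl cC).
rewrite (linmap_tliftE _ _ lq); apply: eq_tlift => c1 c2.
by rewrite proj2_tmul hp (linmapZ lq).
Qed.

(** Apply [proj2] to the first leg and [proj1] to the second leg of the comultiplicativity equation:
    one side becomes the flipped pairing, the other the pairing with [p] and [q] interchanged. *)
Lemma comult_pairing_flip c :
  (forall c, eA (p c) = eC c) -> (forall c, eB (q c) = eC c) ->
  comult DC (unif_D DA DB) pairing ->
  tlift (fun c1 c2 => q c1 \ot p c2) (DC c) = tlift (fun c1 c2 => q c2 \ot p c1) (DC c).
Proof.
move=> hp hq /(_ c).
move/(congr1 (tlift (fun x1 x2 => proj2 x1 \ot proj1 x2))).
rewrite tensor_flip tlift_tlift; last lin.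
rewrite /pairing tlift_tlift; last lin.
move=> e; symmetry; move: e.
under eq_tlift => c1 c2 do [rewrite tlift_tmul; last by lin].
move=> ->; apply: eq_tlift => c1 c2; rewrite tlift_tmul; last lin.
by rewrite proj1_pairing // proj2_pairing.
Qed.

(** Rebrackets a fourfold Sweedler sum so that the two middle legs arise from a single
    comultiplication, where an identity about two legs can be applied. *)
Lemma coassoc4 (U : lmodType k) (F : C -> C -> C -> C -> U) c :
  (forall x y z, linmap (F x y z)) -> (forall x y z, linmap (fun t => F x y t z)) ->
  (forall x y z, linmap (fun t => F x t y z)) -> (forall x y z, linmap (fun t => F t x y z)) ->
  tlift (fun c1 c2 => tlift (fun x y => tlift (fun z t => F x y z t) (DC c2)) (DC c1)) (DC c)
  = tlift (fun c1 c2 => tlift (fun y z => tlift (fun x t => F c1 x t z) (DC y)) (DC c2)) (DC c).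
Proof.
move=> h1 h2 h3 h4.
rewrite (coassocE (F := fun x y z => tlift (F x y) (DC z)) c cC); [|lin..].
apply: eq_tlift => x y.
by rewrite -(coassocE (F := fun t z w => F x t z w) _ cC); [|lin..].
Qed.

Lemma comult_pairing :
  comult DC DA p -> comult DC DB q ->
  (forall c, tlift (fun c1 c2 => q c1 \ot p c2) (DC c)
    = tlift (fun c1 c2 => q c2 \ot p c1) (DC c)) ->
  comult DC (unif_D DA DB) pairing.
Proof.
move=> hp hq h c; rewrite {1}/pairing (linmap_tliftE _ _ l4).
transitivity (tlift (fun c1 c2 => tlift (fun x y => tlift (fun z t =>
   (p x \ot q z) \ot (p y \ot q t)) (DC c2)) (DC c1)) (DC c)).
  apply: eq_tlift => c1 c2; rewrite (tensorD_tmul cA cB) hp hq tlift_tlift; last lin.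
  apply: eq_tlift => x y; rewrite tlift_tmul; last lin.
  rewrite tlift_tlift; last lin.
  by apply: eq_tlift => z t; rewrite tlift_tmul; last lin.
transitivity (tlift (fun c1 c2 => tlift (fun x y => tlift (fun z t =>
   (p x \ot q y) \ot (p z \ot q t)) (DC c2)) (DC c1)) (DC c)); last first.
  apply: eq_tlift => c1 c2; rewrite /pairing tmul_tliftl.
  by apply: eq_tlift => x y; rewrite tmul_tliftr.
(* Both sides are now fourfold sums over [c] that differ only in which middle leg goes to [p] and
   which to [q]. *)
rewrite (coassoc4 (F := fun x y z t => (p x \ot q z) \ot (p y \ot q t))); [|lin..].
rewrite (coassoc4 (F := fun x y z t => (p x \ot q y) \ot (p z \ot q t))); [|lin..].
apply: eq_tlift => x u; apply: eq_tlift => v w.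
(* The commutation hypothesis is used on the element [v] that carries the middle legs, with the
   outer legs [x] and [w] fixed. *)
have /(congr1 (tlift (fun b a => (p x \ot b) \ot (a \ot q w)))) := h v.
rewrite !tlift_tlift; [|lin..].
move=> e; transitivity (tlift (fun v1 v2 : C =>
      tlift (fun (b : B) (a : A) => p x \ot b \ot (a \ot q w)) (q v2 \ot p v1)) (DC v)).
  by apply: eq_tlift => y z; rewrite tlift_tmul //; lin.
by rewrite -e; apply: eq_tlift => y z; rewrite tlift_tmul //; lin.
Qed.

End Pairing.

(** * The unified product *)

Section UnifiedProduct.
Variables (k : fieldType) (A : lmodType k) (mA : A -> A -> A) (oneA : A)
  (DA : A -> tensor A A) (eA : A -> k)
  (H : lmodType k) (mH : H -> H -> H) (oneH : H)
  (DH : H -> tensor H H) (eH : H -> k)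
  (ra : H -> A -> H) (la : H -> A -> A) (f : H -> H -> A).
Hypothesis hA : bialgebra mA oneA DA eA.
Hypothesis hE : extending_datum oneA DA eA mH oneH DH eH ra la f.

Let cA := bialg_coalg hA.
Let cH := ed_coalg hE.
Let lDA := coalg_linD cA.
Let lDH := coalg_linD cH.
Let leA := coalg_line cA.
Let leH := coalg_line cH.
Let bmA := bialg_bilin hA.
Let bmH := ed_mul_bilin hE.
Let bra := ed_ra_bilin hE.
Let bla := ed_la_bilin hE.
Let bf := ed_f_bilin hE.

Let D := unif_D DA DH.
Let e := unif_e eA eH.
Let m := unif_mul mA DA mH DH ra la f.
Let p1 := @proj1 k A H eH.
Let p2 := @proj2 k A H eA.

(** * The product as a composite of [twist], [cocycle] and left multiplication by [A] *)

Definition twist := pairing (unif_D DH DA) (tlift la) (tlift ra).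
Definition cocycle := pairing (unif_D DH DH) (tlift f) (tlift mH).
Definition lact a (x : tensor A H) := tlift (fun u v => mA a u \ot v) x.
(** This is right multiplication by [inH l], as [mul_inH] confirms, written as the left [A]-linear
    extension of [cocycle]. *)
Definition ract (x : tensor A H) l := tlift (fun u v => lact u (cocycle (v \ot l))) x.
Let inA (a : A) : tensor A H := a \ot oneH.
Let inH (h : H) : tensor A H := oneA \ot h.

Let lD : linmap D := linmap_tensorD cA cH.
Let le : linform e := linform_tensore cA cH.
Let lp1 : linmap p1 := @linmap_proj1 _ A _ _ _ cH.
Let lp2 : linmap p2 := @linmap_proj2 _ _ H _ _ cA.
Let lDHA : linmap (unif_D DH DA) := linmap_tensorD cH cA.
Let lDHH : linmap (unif_D DH DH) := linmap_tensorD cH cH.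

Lemma linmap_twist : linmap twist. Proof. by rewrite /twist /pairing; lin. Qed.
Lemma linmap_cocycle : linmap cocycle. Proof. by rewrite /cocycle /pairing; lin. Qed.
Let ltw := linmap_twist.
Let lco := linmap_cocycle.

Lemma bilin_lact : bilin lact. Proof. by rewrite /lact; lin. Qed.
Let blact := bilin_lact.
Lemma bilin_ract : bilin ract. Proof. by rewrite /ract; lin. Qed.
Let bract := bilin_ract.

Lemma lact_tmul a u v : lact a (u \ot v) = mA a u \ot v.
Proof. by rewrite /lact tlift_tmul //; lin. Qed.

Lemma ract_tmul u v l : ract (u \ot v) l = lact u (cocycle (v \ot l)).
Proof. by rewrite /ract tlift_tmul //; lin. Qed.

Lemma twistE h c : twist (h \ot c) = tlift (fun h1 h2 => tlift (fun c1 c2 =>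
  la h1 c1 \ot ra h2 c2) (DA c)) (DH h).
Proof.
rewrite /twist /pairing (tlift_tensorD cH cA); last lin.
by do 2!apply: eq_tlift => ? ?; rewrite !tlift_tmul.
Qed.

Lemma cocycleE h g : cocycle (h \ot g) = tlift (fun h1 h2 => tlift (fun g1 g2 =>
  f h1 g1 \ot mH h2 g2) (DH g)) (DH h).
Proof.
rewrite /cocycle /pairing (tlift_tensorD cH cH); last lin.
by do 2!apply: eq_tlift => ? ?; rewrite !tlift_tmul.
Qed.

Lemma lactA a b x : lact a (lact b x) = lact (mA a b) x.
Proof.
move: x; apply: tensor_ext; [lin | lin | move=> u v].
by rewrite !lact_tmul (bialg_assoc hA).
Qed.

(** The threefold sums over [h] and [c] are rebracketed to the right: the outer splitting belongs to
    [twist], and the inner one is the comultiplication of [ra h' c'] inside [cocycle]. *)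
Lemma unif_mul_elE a h c g :
  unif_mul_el mA DA mH DH ra la f a h c g = lact a (ract (twist (h \ot c)) g).
Proof.
pose G h1 h2 h3 c1 c2 c3 := tlift (fun g1 g2 =>
  mA (mA a (la h1 c1)) (f (ra h2 c2) g1) \ot mH (ra h3 c3) g2) (DH g).
rewrite /unif_mul_el /sw3.
rewrite (coassocE (F := fun h1 h2 h3 => tlift (fun c' c3 => tlift (fun c1 c2 =>
  G h1 h2 h3 c1 c2 c3) (DA c')) (DA c)) h cH); try by rewrite /G; lin.
rewrite twistE (bilin_tliftl _ _ _ bract) (bilin_tliftr _ _ _ blact).
apply: eq_tlift => h1 h'.
rewrite (bilin_tliftl _ _ _ bract) (bilin_tliftr _ _ _ blact).
under eq_tlift => h2 h3.
  rewrite (coassocE (F := G h1 h2 h3) c cA); try by rewrite /G; lin.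
  over.
rewrite tlift_exchange; apply: eq_tlift => c1 c'.
rewrite ract_tmul lactA cocycleE (bilin_tliftr _ _ _ blact).
under [RHS]eq_tlift => v1 v2 do rewrite (bilin_tliftr _ _ _ blact).
rewrite (tlift_comult2 _ (ed_ra_D hE h' c')); last lin.
do 3!apply: eq_tlift => ? ?.
by rewrite lact_tmul.
Qed.

Lemma unif_mul_tmul a h c g :
  m (a \ot h) (c \ot g) = lact a (ract (twist (h \ot c)) g).
Proof.
rewrite /m /unif_mul.
transitivity (tlift (fun a h => tlift (fun c g =>
    lact a (ract (twist (h \ot c)) g)) (c \ot g)) (a \ot h)).
  by do 2!apply: eq_tlift => ? ?; exact: unif_mul_elE.
by rewrite !tlift_tmul //; lin.
Qed.

Lemma bilin_unif_mul : bilin m.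
Proof.
have h x y : m x y = tlift (fun a h => tlift (fun c g =>
    lact a (ract (twist (h \ot c)) g)) y) x.
  by do 2!apply: eq_tlift => ? ?; exact: unif_mul_elE.
have b : bilin (fun x y => tlift (fun a h => tlift (fun c g =>
    lact a (ract (twist (h \ot c)) g)) y) x) by lin.
by case: b => b1 b2 b3 b4; split=> *; rewrite !h.
Qed.
Let bm := bilin_unif_mul.

(** * Units, and products with the images of [A] and [H] *)

Lemma twist1 h : twist (h \ot oneA) = inH h.
Proof.
rewrite twistE (bialg_D1 hA) /inH -[h in RHS](coalg_counitl cH) tmul_tliftr.
apply: eq_tlift => h1 h2; rewrite tlift_tmul; last lin.
by rewrite (ed_la1 hE) (ed_ra1 hE) tmulZl tmulZr.
Qed.

Lemma twist1l c : twist (oneH \ot c) = inA c.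
Proof.
rewrite twistE (ed_D1 hE) tlift_tmul; last lin.
rewrite /inA -[c in RHS](coalg_counitr cA) tmul_tliftl.
by apply: eq_tlift => c1 c2; rewrite (ed_1la hE) (ed_1ra hE) tmulZl tmulZr.
Qed.

Lemma cocycle1 h : cocycle (h \ot oneH) = inH h.
Proof.
rewrite cocycleE (ed_D1 hE) /inH -[h in RHS](coalg_counitl cH) tmul_tliftr.
apply: eq_tlift => h1 h2; rewrite tlift_tmul; last lin.
by rewrite (ed_f1 hE) (ed_unitr hE) tmulZl tmulZr.
Qed.

Lemma cocycle1l h : cocycle (oneH \ot h) = inH h.
Proof.
rewrite cocycleE (ed_D1 hE) tlift_tmul; last lin.
rewrite /inH -[h in RHS](coalg_counitl cH) tmul_tliftr.
by apply: eq_tlift => h1 h2; rewrite (ed_1f hE) (ed_unitl hE) tmulZl tmulZr.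
Qed.

Lemma lact1 x : lact oneA x = x.
Proof.
by rewrite /lact -[RHS]tensorE; apply: eq_tlift => u v; rewrite (bialg_unitl hA).
Qed.

Lemma lact_inH a h : lact a (inH h) = a \ot h.
Proof. by rewrite lact_tmul (bialg_unitr hA). Qed.

Lemma lact_ract a x l : ract (lact a x) l = lact a (ract x l).
Proof.
move: x; apply: tensor_ext; [lin | lin | move=> u v].
by rewrite lact_tmul !ract_tmul lactA.
Qed.

Lemma ract_inH h l : ract (inH h) l = cocycle (h \ot l).
Proof. by rewrite ract_tmul lact1. Qed.

Lemma ract_inA a l : ract (inA a) l = a \ot l.
Proof. by rewrite ract_tmul cocycle1l lact_inH. Qed.

Lemma ract1 x : ract x oneH = x.
Proof.
move: x; apply: tensor_ext; [lin | lin | move=> u v].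
by rewrite ract_tmul cocycle1 lact_inH.
Qed.

Lemma mul_lact a x y : m (lact a x) y = lact a (m x y).
Proof.
move: x; apply: tensor_ext; [lin | lin | move=> u v].
move: y; apply: tensor_ext; [lin | lin | move=> c g].
by rewrite lact_tmul !unif_mul_tmul lactA.
Qed.

Lemma mul_inA a x : m (inA a) x = lact a x.
Proof.
move: x; apply: tensor_ext; [lin | lin | move=> c g].
by rewrite unif_mul_tmul twist1l ract_inA.
Qed.

Lemma mul_inH x l : m x (inH l) = ract x l.
Proof.
move: x; apply: tensor_ext; [lin | lin | move=> u v].
by rewrite unif_mul_tmul twist1 ract_inH ract_tmul.
Qed.

Lemma mul_tmul_inA u v c : m (u \ot v) (inA c) = lact u (twist (v \ot c)).
Proof. by rewrite unif_mul_tmul ract1. Qed.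

(** This is associativity for [x], [inA c], [inH g]; it follows from the shape of the product
    because [ract] commutes with left multiplication by [A]. *)
Lemma mul_tmul x c g : m x (c \ot g) = ract (m x (inA c)) g.
Proof.
move: x; apply: tensor_ext; [lin | lin | move=> u v].
by rewrite mul_tmul_inA unif_mul_tmul lact_ract.
Qed.

Lemma mul_inH_inA h c : m (inH h) (inA c) = twist (h \ot c).
Proof. by rewrite mul_tmul_inA lact1. Qed.

Lemma mul_inH_inH g h : m (inH g) (inH h) = cocycle (g \ot h).
Proof. by rewrite mul_inH ract_inH. Qed.

Lemma mul_inH_tmul h c g : m (inH h) (c \ot g) = ract (twist (h \ot c)) g.
Proof. by rewrite mul_tmul mul_inH_inA. Qed.

Lemma mul1x x : m (oneA \ot oneH) x = x.
Proof. by rewrite mul_inA lact1. Qed.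

Lemma mulx1 x : m x (oneA \ot oneH) = x.
Proof. by rewrite mul_inH ract1. Qed.

(** * Projections of products *)

Let ela t : eA (tlift la t) = unif_e eH eA t.
Proof. by apply: tensore_tlift => //; exact: ed_la_e hE. Qed.
Let era t : eH (tlift ra t) = unif_e eH eA t.
Proof. by apply: tensore_tlift => //; exact: ed_ra_e hE. Qed.
Let ef t : eA (tlift f t) = unif_e eH eH t.
Proof. by apply: tensore_tlift => //; exact: ed_f_e hE. Qed.
Let cHA := tensor_coalgebra cH cA.
Let cHH := tensor_coalgebra cH cH.

Lemma proj1_lact a x : p1 (lact a x) = mA a (p1 x).
Proof.
move: x; apply: tensor_ext; [lin | lin | move=> u v].
by rewrite lact_tmul /p1 !(proj1_tmul cH); case: bmA => _ _ _ ->.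
Qed.

Lemma proj2_lact a x : p2 (lact a x) = eA a *: p2 x.
Proof.
move: x; apply: tensor_ext; [lin | lin | move=> u v].
by rewrite lact_tmul /p2 !(proj2_tmul cA) (bialg_emul hA) scalerA.
Qed.

Lemma proj1_twist h c : p1 (twist (h \ot c)) = la h c.
Proof.
rewrite /p1 /twist (proj1_pairing cH cHA); first by rewrite tlift_tmul.
- by lin.
- exact: era.
Qed.

Lemma proj2_twist h c : p2 (twist (h \ot c)) = ra h c.
Proof.
rewrite /p2 /twist (proj2_pairing cA cHA); first by rewrite tlift_tmul.
- by lin.
- exact: ela.
Qed.

Lemma proj2_cocycle g h : p2 (cocycle (g \ot h)) = mH g h.
Proof.
rewrite /p2 /cocycle (proj2_pairing cA cHH); first by rewrite tlift_tmul.
- by lin.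
- exact: ef.
Qed.

Lemma proj2_ract x l : p2 (ract x l) = mH (p2 x) l.
Proof.
move: x; apply: tensor_ext; [lin | lin | move=> u v].
rewrite ract_tmul proj2_lact proj2_cocycle /p2 (proj2_tmul cA).
by case: bmH => _ -> _ _.
Qed.

Lemma proj2_mul_inA x b : p2 (m x (inA b)) = ra (p2 x) b.
Proof.
move: x; apply: tensor_ext; [lin | lin | move=> u v].
rewrite mul_tmul_inA proj2_lact proj2_twist /p2 (proj2_tmul cA).
by case: bra => _ -> _ _.
Qed.

Lemma proj1_mul_inA u v b : p1 (m (u \ot v) (inA b)) = mA u (la v b).
Proof. by rewrite mul_tmul_inA proj1_lact proj1_twist. Qed.

(** The second projection of a product sees the left factor only through its own second projection,
    since the counit of [A] is multiplicative. *)
Lemma proj2_mul x c l : p2 (m x (c \ot l)) = mH (ra (p2 x) c) l.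
Proof. by rewrite mul_tmul proj2_ract proj2_mul_inA. Qed.

Lemma tensore_proj2 x : e x = eH (p2 x).
Proof.
move: x; apply: (@tensor_ext k k^o); [lin | lin | move=> u v].
by rewrite /e /p2 (tensore_tmul cA cH) (proj2_tmul cA) (linformZ leH).
Qed.

(** * Comultiplicativity of the product *)

Lemma lact_comult a x : D (lact a x) =
  tlift (fun a1 a2 => tlift (fun x1 x2 => lact a1 x1 \ot lact a2 x2) (D x)) (DA a).
Proof.
move: x; apply: tensor_ext; [lin | lin | move=> u v].
rewrite lact_tmul /D (tensorD_tmul cA cH) (tlift_comult2 _ (bialg_Dmul hA a u)); last lin.
apply: eq_tlift => a1 a2; rewrite (tlift_tensorD cA cH); last lin.
by do 2!apply: eq_tlift => ? ?; rewrite !lact_tmul.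
Qed.

Section Comultiplicative.
Hypothesis tw_comult : comult (unif_D DH DA) D twist.
Hypothesis co_comult : comult (unif_D DH DH) D cocycle.

Lemma ract_comult x l : D (ract x l) =
  tlift (fun x1 x2 => tlift (fun l1 l2 => ract x1 l1 \ot ract x2 l2) (DH l)) (D x).
Proof.
move: x; apply: tensor_ext; [lin | lin | move=> u v].
rewrite ract_tmul lact_comult {2}/D (tlift_tensorD cA cH); last lin.
apply: eq_tlift => u1 u2.
rewrite (tlift_comult _ _ co_comult); last lin.
rewrite (tlift_tensorD cH cH); last lin.
by do 2!apply: eq_tlift => ? ?; rewrite !ract_tmul.
Qed.

Lemma mul_comult x y : D (m x y) =
  tlift (fun x1 x2 => tlift (fun y1 y2 => m x1 y1 \ot m x2 y2) (D y)) (D x).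
Proof.
move: x; apply: tensor_ext; [lin | lin | move=> a h].
move: y; apply: tensor_ext; [lin | lin | move=> c g].
rewrite unif_mul_tmul lact_comult [in RHS]/D (tlift_tensorD cA cH); last lin.
apply: eq_tlift => a1 a2.
rewrite (tlift_comult2 _ (ract_comult _ _)); last lin.
rewrite (tlift_comult _ _ tw_comult); last lin.
rewrite (tlift_tensorD cH cA); last lin.
apply: eq_tlift => h1 h2; rewrite (tlift_tensorD cA cH); last lin.
by do 2!apply: eq_tlift => ? ?; rewrite !unif_mul_tmul.
Qed.

Lemma tlift_mul (U : lmodType k) (b : tensor A H -> tensor A H -> U) x y : bilin b ->
  tlift b (D (m x y)) =
  tlift (fun x1 x2 => tlift (fun y1 y2 => b (m x1 y1) (m x2 y2)) (D y)) (D x).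
Proof. by move=> hb; exact: (tlift_comult2 hb (mul_comult x y)). Qed.

(** Both bracketings are comultiplicative in [u], [v], [w], so [tensor_proj] rebuilds each from its
    projections, with [p1] taken on the first legs and [p2] on the second. The maps [r], [s], [t]
    stand for the inclusions of [A] and [H]. *)
Lemma assoc_proj (U V W : lmodType k) (DU : U -> tensor U U) (DV : V -> tensor V V)
  (DW : W -> tensor W W) (r : U -> tensor A H) (s : V -> tensor A H) (t : W -> tensor A H) :
  comult DU D r -> comult DV D s -> comult DW D t ->
  (forall u v w, p1 (m (m (r u) (s v)) (t w)) = p1 (m (r u) (m (s v) (t w)))) ->
  (forall u v w, p2 (m (m (r u) (s v)) (t w)) = p2 (m (r u) (m (s v) (t w)))) ->
  forall u v w, m (m (r u) (s v)) (t w) = m (r u) (m (s v) (t w)).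
Proof.
move=> hr hs ht e1 e2 u v w.
rewrite -[LHS](tensor_proj cA cH) -[RHS](tensor_proj cA cH).
rewrite !tlift_mul; [|lin..].
rewrite (tlift_comult _ _ hr); last lin.
rewrite (tlift_comult _ _ hr); last lin.
apply: eq_tlift => u1 u2; rewrite tlift_mul; last lin.
rewrite (tlift_comult _ _ hs); last lin.
rewrite (tlift_comult _ _ hs); last lin.
apply: eq_tlift => v1 v2.
rewrite (tlift_comult _ _ ht); last lin.
rewrite (tlift_comult _ _ ht); last lin.
by apply: eq_tlift => w1 w2; rewrite -/p1 -/p2 e1 e2.
Qed.

End Comultiplicative.

Lemma inH_comult : comult DH D inH.
Proof.
move=> h; rewrite /D /inH (tensorD_tmul cA cH) (bialg_D1 hA) tlift_tmul //; lin.
Qed.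

Lemma inA_comult : comult DA D inA.
Proof.
move=> a; rewrite /D /inA (tensorD_tmul cA cH) (ed_D1 hE).
by apply: eq_tlift => a1 a2; rewrite tlift_tmul //; lin.
Qed.

(** * Projections of both bracketings on triples from [A] and [H] *)

Lemma mul_inA_inA a b : m (inA a) (inA b) = inA (mA a b).
Proof. by rewrite mul_inA lact_tmul. Qed.

Lemma proj1_gab_l g a b : p1 (m (m (inH g) (inA a)) (inA b)) =
  tlift (fun g1 g2 => tlift (fun a1 a2 => mA (la g1 a1) (la (ra g2 a2) b)) (DA a)) (DH g).
Proof.
have l : linmap (fun x => p1 (m x (inA b))) by lin.
rewrite mul_inH_inA twistE (linmap_tliftE _ _ l); apply: eq_tlift => g1 g2.
by rewrite (linmap_tliftE _ _ l); apply: eq_tlift => a1 a2; rewrite proj1_mul_inA.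
Qed.

Lemma proj1_gab_r g a b : p1 (m (inH g) (m (inA a) (inA b))) = la g (mA a b).
Proof. by rewrite mul_inA_inA mul_inH_inA proj1_twist. Qed.

Lemma proj2_gab_l g a b : p2 (m (m (inH g) (inA a)) (inA b)) = ra (ra g a) b.
Proof. by rewrite proj2_mul_inA mul_inH_inA proj2_twist. Qed.

Lemma proj2_gab_r g a b : p2 (m (inH g) (m (inA a) (inA b))) = ra g (mA a b).
Proof. by rewrite mul_inA_inA mul_inH_inA proj2_twist. Qed.

Lemma proj1_gha_l g h a : p1 (m (m (inH g) (inH h)) (inA a)) =
  tlift (fun g1 g2 => tlift (fun h1 h2 => mA (f g1 h1) (la (mH g2 h2) a)) (DH h)) (DH g).
Proof.
have l : linmap (fun x => p1 (m x (inA a))) by lin.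
rewrite mul_inH_inH cocycleE (linmap_tliftE _ _ l); apply: eq_tlift => g1 g2.
by rewrite (linmap_tliftE _ _ l); apply: eq_tlift => h1 h2; rewrite proj1_mul_inA.
Qed.

Lemma proj2_gha_l g h a : p2 (m (m (inH g) (inH h)) (inA a)) = ra (mH g h) a.
Proof. by rewrite proj2_mul_inA mul_inH_inH proj2_cocycle. Qed.

Let p2inH h : p2 (inH h) = h.
Proof. by rewrite /p2 (proj2_tmul cA) (bialg_e1 hA) scale1r. Qed.

Lemma proj2_gha_r g h a : p2 (m (inH g) (m (inH h) (inA a))) =
  tlift (fun h1 h2 => tlift (fun a1 a2 => mH (ra g (la h1 a1)) (ra h2 a2)) (DA a)) (DH h).
Proof.
rewrite mul_inH_inA twistE (bilin_tliftr _ _ _ bm) (linmap_tliftE _ _ lp2).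
apply: eq_tlift => h1 h2; rewrite (bilin_tliftr _ _ _ bm) (linmap_tliftE _ _ lp2).
by apply: eq_tlift => a1 a2; rewrite proj2_mul p2inH.
Qed.

Lemma proj2_ghl_l g h l : p2 (m (m (inH g) (inH h)) (inH l)) = mH (mH g h) l.
Proof. by rewrite mul_inH proj2_ract mul_inH_inH proj2_cocycle. Qed.

Lemma proj2_ghl_r g h l : p2 (m (inH g) (m (inH h) (inH l))) =
  tlift (fun h1 h2 => tlift (fun l1 l2 => mH (ra g (f h1 l1)) (mH h2 l2)) (DH l)) (DH h).
Proof.
rewrite mul_inH_inH cocycleE (bilin_tliftr _ _ _ bm) (linmap_tliftE _ _ lp2).
apply: eq_tlift => h1 h2; rewrite (bilin_tliftr _ _ _ bm) (linmap_tliftE _ _ lp2).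
by apply: eq_tlift => l1 l2; rewrite proj2_mul p2inH.
Qed.

Section CounitMul.
Hypothesis emH : forall g h, eH (mH g h) = eH g * eH h.

(** Here the first projection applies the counit of [H] to [mH], whence the hypothesis [emH]. *)
Lemma proj1_cocycle g h : p1 (cocycle (g \ot h)) = f g h.
Proof.
rewrite /p1 /cocycle (proj1_pairing cH cHH); first by rewrite tlift_tmul.
- by lin.
- exact: tensore_tlift.
Qed.

Lemma proj1_ract_tmul u v l : p1 (ract (u \ot v) l) = mA u (f v l).
Proof. by rewrite ract_tmul proj1_lact proj1_cocycle. Qed.

Lemma proj1_inH_mul g c l : p1 (m (inH g) (c \ot l)) =
  tlift (fun g1 g2 => tlift (fun c1 c2 => mA (la g1 c1) (f (ra g2 c2) l)) (DA c)) (DH g).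
Proof.
rewrite mul_inH_tmul twistE (bilin_tliftl _ _ _ bract) (linmap_tliftE _ _ lp1).
apply: eq_tlift => g1 g2; rewrite (bilin_tliftl _ _ _ bract) (linmap_tliftE _ _ lp1).
by apply: eq_tlift => c1 c2; rewrite proj1_ract_tmul.
Qed.

Lemma proj1_gha_r g h a : p1 (m (inH g) (m (inH h) (inA a))) =
  tlift (fun g1 g2 => sw3 DH (fun h1 h2 h3 => sw3 DA (fun a1 a2 a3 =>
       mA (la g1 (la h1 a1)) (f (ra g2 (la h2 a2)) (ra h3 a3))) a) h) (DH g).
Proof.
rewrite mul_inH_inA twistE (bilin_tliftr _ _ _ bm) (linmap_tliftE _ _ lp1).
rewrite /sw3 tlift_exchange; apply: eq_tlift => h' h3.
rewrite (bilin_tliftr _ _ _ bm) (linmap_tliftE _ _ lp1).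
under [RHS]eq_tlift => g1 g2 do rewrite tlift_exchange.
rewrite [RHS]tlift_exchange; apply: eq_tlift => a' a3.
rewrite proj1_inH_mul; apply: eq_tlift => g1 g2.
(* The first two legs of [h] and of [a] come from comultiplying [la h' a']; the third ones were
   split off by [twist]. *)
by rewrite (tlift_comult2 _ (ed_la_D hE h' a')) //; lin.
Qed.

Lemma proj1_ghl_r g h l : p1 (m (inH g) (m (inH h) (inH l))) =
  tlift (fun g1 g2 => sw3 DH (fun h1 h2 h3 => sw3 DH (fun l1 l2 l3 =>
       mA (la g1 (f h1 l1)) (f (ra g2 (f h2 l2)) (mH h3 l3))) l) h) (DH g).
Proof.
rewrite mul_inH_inH cocycleE (bilin_tliftr _ _ _ bm) (linmap_tliftE _ _ lp1).
rewrite /sw3 tlift_exchange; apply: eq_tlift => h' h3.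
rewrite (bilin_tliftr _ _ _ bm) (linmap_tliftE _ _ lp1).
under [RHS]eq_tlift => g1 g2 do rewrite tlift_exchange.
rewrite [RHS]tlift_exchange; apply: eq_tlift => l' l3.
rewrite proj1_inH_mul; apply: eq_tlift => g1 g2.
by rewrite (tlift_comult2 _ (ed_f_D hE h' l')) //; lin.
Qed.

Lemma proj1_ghl_l g h l : p1 (m (m (inH g) (inH h)) (inH l)) =
  tlift (fun g1 g2 => tlift (fun h1 h2 => mA (f g1 h1) (f (mH g2 h2) l)) (DH h)) (DH g).
Proof.
rewrite mul_inH_inH mul_inH cocycleE (bilin_tliftl _ _ _ bract) (linmap_tliftE _ _ lp1).
apply: eq_tlift => g1 g2; rewrite (bilin_tliftl _ _ _ bract) (linmap_tliftE _ _ lp1).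
by apply: eq_tlift => h1 h2; rewrite proj1_ract_tmul.
Qed.

End CounitMul.

(** * Associativity from three families of triples *)

Section Associative.
Let assoc3 x y z := m (m x y) z = m x (m y z).
Hypothesis assoc_gab : forall g a b, assoc3 (inH g) (inA a) (inA b).
Hypothesis assoc_gha : forall g h a, assoc3 (inH g) (inH h) (inA a).
Hypothesis assoc_ghl : forall g h l, assoc3 (inH g) (inH h) (inH l).

(** Every [u \ot v] is [lact u (inH v)], and the left factor [u] pulls out of both bracketings. *)
Let assoc_lext y z : (forall g, assoc3 (inH g) y z) -> forall x, assoc3 x y z.
Proof.
move=> h; apply: tensor_ext; [lin | lin | move=> u v].
by rewrite -lact_inH !mul_lact h.
Qed.

(** The pentagon on [x], [y1], [y2], [z]: four of its associativity relations give the fifth. The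
    next lemma solves it for a product in the last slot. *)
Let assoc_mulm x y1 y2 z : assoc3 x y1 y2 -> assoc3 (m x y1) y2 z ->
  assoc3 x y1 (m y2 z) -> assoc3 y1 y2 z -> assoc3 x (m y1 y2) z.
Proof. by rewrite /assoc3 => e1 e2 e3 e4; rewrite -e1 e2 e3 e4. Qed.

Let assoc_mulr x y z1 z2 : assoc3 x y z1 -> assoc3 (m x y) z1 z2 ->
  assoc3 x (m y z1) z2 -> assoc3 y z1 z2 -> assoc3 x y (m z1 z2).
Proof. by rewrite /assoc3 => e1 e2 e3 e4; rewrite -e2 e1 e3 e4. Qed.

Let tmulE a h : a \ot h = m (inA a) (inH h).
Proof. by rewrite mul_inA lact_inH. Qed.

Let assoc_xal x a l : assoc3 x (inA a) (inH l).
Proof. by rewrite /assoc3 -tmulE mul_inH mul_tmul. Qed.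

Let assoc_xab x a b : assoc3 x (inA a) (inA b).
Proof. exact: assoc_lext. Qed.

Let assoc_xa x a z : assoc3 x (inA a) z.
Proof.
move: z; apply: tensor_ext; [lin | lin | move=> b l].
(* The remaining pentagon edge has middle entry [m (inA a) (inA b)], which lies in [A] again, so
   [assoc_xal] covers it. *)
by rewrite tmulE; apply: assoc_mulr => //; rewrite mul_inA_inA.
Qed.

Let assoc_xl x y l : assoc3 x y (inH l).
Proof.
move: y; apply: tensor_ext; [lin | lin | move=> a h].
by rewrite tmulE; apply: assoc_mulm => //; apply: assoc_lext.
Qed.

Let assoc_xh x h z : assoc3 x (inH h) z.
Proof.
move: z; apply: tensor_ext; [lin | lin | move=> b l].
by rewrite tmulE; apply: assoc_mulr => //; apply: assoc_lext.
Qed.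

Lemma mul_assoc : associative m.
Proof.
move=> x y z; symmetry; move: y; apply: tensor_ext; [lin | lin | move=> a h].
by rewrite tmulE; apply: assoc_mulm.
Qed.

End Associative.

(** * The two implications *)

Lemma unified_product_conditions :
  unified_product mA oneA DA eA mH oneH DH eH ra la f ->
  unified_conditions mA oneA DA mH oneH DH eH ra la f.
Proof.
case=> _ _ hass _ _ hD _ he he1.
have eH1 : eH oneH = 1.
  by move: he1; rewrite /unif_one (tensore_tmul cA cH) (bialg_e1 hA) mul1r.
(* The counit of the product factors through [p2], and [p2] sends the product of [inH g] and [inH h]
   to [mH g h]. *)
have emH g h : eH (mH g h) = eH g * eH h.
  have := he (inH g) (inH h); rewrite -/e -/m mul_inH_inH !tensore_proj2 proj2_cocycle.
  by rewrite !p2inH.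
have ass x y z : m (m x y) z = m x (m y z) by rewrite [RHS]hass.
have em t : eH (tlift mH t) = unif_e eH eH t by exact: tensore_tlift.
(* [cocycle] and [twist] are products of comultiplicative inclusions, so multiplicativity of the
   comultiplication makes them comultiplicative. *)
have co : comult (unif_D DH DH) D cocycle.
  apply: tensor_ext; [lin | lin | move=> g h].
  rewrite -mul_inH_inH [LHS]hD (tlift_tensorD cH cH); last lin.
  rewrite (tlift_comult _ _ inH_comult); last lin.
  apply: eq_tlift => g1 g2; rewrite (tlift_comult _ _ inH_comult); last lin.
  by apply: eq_tlift => h1 h2; rewrite -!mul_inH_inH.
have tw : comult (unif_D DH DA) D twist.
  apply: tensor_ext; [lin | lin | move=> g a].
  rewrite -mul_inH_inA [LHS]hD (tlift_tensorD cH cA); last lin.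
  rewrite (tlift_comult _ _ inH_comult); last lin.
  apply: eq_tlift => g1 g2; rewrite (tlift_comult _ _ inA_comult); last lin.
  by apply: eq_tlift => a1 a2; rewrite -!mul_inH_inA.
split=> //.
(* [mH] is [cocycle] followed by the comultiplicative projection [p2]. *)
- move=> g h; rewrite -proj2_cocycle -[LHS](tensor_proj22 cA cH).
  rewrite (tlift_comult _ _ co); last lin.
  rewrite (tlift_tensorD cH cH); last lin.
  by do 2!apply: eq_tlift => ? ?; rewrite -!/(p2 _) !proj2_cocycle.
- exact: ed_D1 hE.
(* Apart from the unit law of the action, the conditions from (2b) to (2g) are each one projection
   of associativity on one kind of triple. *)
- by move=> h a b; rewrite -proj2_gab_l ass proj2_gab_r.
- exact: ed_ra1 hE.
- by move=> g h l; rewrite -proj2_ghl_l ass proj2_ghl_r.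
- by move=> g a b; rewrite -proj1_gab_r -ass proj1_gab_l.
- by move=> g h a; rewrite -proj2_gha_l ass proj2_gha_r.
- by move=> g h a; rewrite -(proj1_gha_r emH) -ass proj1_gha_l.
- by move=> g h l; rewrite -(proj1_ghl_r emH) -ass (proj1_ghl_l emH).
- move=> g a.
  have := comult_pairing_flip cA cH cHA (linmap_tlift bla) (linmap_tlift bra)
    (g \ot a) ela era tw.
  rewrite !(tlift_tensorD cH cA); [|lin..].
  under eq_tlift => ? ? do under eq_tlift => ? ? do rewrite !tlift_tmul //.
  by under [in X in _ = X -> _]eq_tlift => ? ? do under eq_tlift => ? ? do rewrite !tlift_tmul //.
- move=> g h.
  have := comult_pairing_flip cA cH cHH (linmap_tlift bf) (linmap_tlift bmH)
    (g \ot h) ef em co.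
  rewrite !(tlift_tensorD cH cH); [|lin..].
  under eq_tlift => ? ? do under eq_tlift => ? ? do rewrite !tlift_tmul //.
  by under [in X in _ = X -> _]eq_tlift => ? ? do under eq_tlift => ? ? do rewrite !tlift_tmul //.
Qed.

Lemma unified_conditions_product :
  unified_conditions mA oneA DA mH oneH DH eH ra la f ->
  unified_product mA oneA DA eA mH oneH DH eH ra la f.
Proof.
case=> c2aD _ emH eH1 c2b _ c2c c2d c2e c2f c2g c2h c2i.
have tw : comult (unif_D DH DA) D twist.
  apply: (comult_pairing cA cH cHA); [lin | lin | | | ].
  - exact: (comult_tlift cA cH cA bla (ed_la_D hE)).
  - exact: (comult_tlift cH cH cA bra (ed_ra_D hE)).
  (* The commutation needed for the pairing is (2h) on pure tensors; for [cocycle] it is (2i). *)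
  - apply: tensor_ext; [lin | lin | move=> g a].
    rewrite !(tlift_tensorD cH cA); [|lin..].
    under eq_tlift => ? ? do under eq_tlift => ? ? do rewrite !tlift_tmul //.
    by rewrite c2h; do 2!apply: eq_tlift => ? ?; rewrite !tlift_tmul.
have co : comult (unif_D DH DH) D cocycle.
  apply: (comult_pairing cA cH cHH); [lin | lin | | | ].
  - exact: (comult_tlift cA cH cH bf (ed_f_D hE)).
  - exact: (comult_tlift cH cH cH bmH c2aD).
  - apply: tensor_ext; [lin | lin | move=> g a].
    rewrite !(tlift_tensorD cH cH); [|lin..].
    under eq_tlift => ? ? do under eq_tlift => ? ? do rewrite !tlift_tmul //.
    by rewrite c2i; do 2!apply: eq_tlift => ? ?; rewrite !tlift_tmul.
split.
- exact: tensor_coalgebra.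
- exact: bm.
(* On each of the three families, [assoc_proj] leaves one equation in [A] and one in [H], and these
   are the stated conditions. *)
- apply: mul_assoc => g ? ?.
  + apply: (assoc_proj tw co inH_comult inA_comult inA_comult) => {}g a b.
      by rewrite proj1_gab_l proj1_gab_r c2d.
    by rewrite proj2_gab_l proj2_gab_r c2b.
  + apply: (assoc_proj tw co inH_comult inH_comult inA_comult) => {}g h a.
      by rewrite proj1_gha_l (proj1_gha_r emH) c2f.
    by rewrite proj2_gha_l proj2_gha_r c2e.
  + apply: (assoc_proj tw co inH_comult inH_comult inH_comult) => {}g h l.
      by rewrite (proj1_ghl_l emH) (proj1_ghl_r emH) c2g.
    by rewrite proj2_ghl_l proj2_ghl_r c2c.
- exact: mul1x.
- exact: mulx1.
- exact: mul_comult.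
- by rewrite /unif_one [LHS]inA_comult (bialg_D1 hA) tlift_tmul //; lin.
(* Since the counit factors through [p2], its multiplicativity reduces to that of [eH] on [mH] and
   its compatibility with [ra]. *)
- move=> x y; rewrite -/e -/m; move: x; apply: (@tensor_ext k k^o); [lin | lin | move=> u v].
  move: y; apply: (@tensor_ext k k^o); [lin | lin | move=> c l].
  rewrite !tensore_proj2 proj2_mul emH (ed_ra_e hE) /p2 !(proj2_tmul cA) !(linformZ leH).
  by rewrite !mulrA.
- by rewrite /unif_one (tensore_tmul cA cH) (bialg_e1 hA) eH1 mulr1.
Qed.

End UnifiedProduct.

Theorem theorem2p3 (k : fieldType)
  (A : lmodType k) (mA : A -> A -> A) (oneA : A)
  (DA : A -> tensor A A) (eA : A -> k)
  (H : lmodType k) (mH : H -> H -> H) (oneH : H)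
  (DH : H -> tensor H H) (eH : H -> k)
  (ra : H -> A -> H) (la : H -> A -> A) (f : H -> H -> A) :
  bialgebra mA oneA DA eA ->
  extending_datum oneA DA eA mH oneH DH eH ra la f ->
  (unified_product mA oneA DA eA mH oneH DH eH ra la f <->
   unified_conditions mA oneA DA mH oneH DH eH ra la f).
Proof.
move=> hA hE; split.
- exact: unified_product_conditions hA hE.
- exact: unified_conditions_product hA hE.
Qed.
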